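(* Let $\mathbb{F}$ be an algebraically closed field of characteristic $>3$. Then the COD of $\mathfrak{sl}_3(\mathbb{F})$ is unique up to conjugacy: any two CODs of $\mathfrak{sl}_3(\mathbb{F})$ are conjugate.
   Context: $\mathfrak{sl}_n(\mathbb{F})$ denotes the Lie algebra of $n\times n$ traceless matrices over $\mathbb{F}$. A Cartan subalgebra is a nilpotent self-normalizing subalgebra. A classical Cartan subalgebra of $\mathfrak{L}=\mathfrak{sl}_n(\mathbb{F})$ (with $\ell=\mathrm{char}\,\mathbb{F}$) is an abelian Cartan subalgebra $H$ such that: (a) $\mathfrak{L}=\bigoplus_\alpha \mathfrak{L}_\alpha$ with $\mathfrak{L}_\alpha=\{x: [x,h]=\alpha(h)x\ \forall h\in H\}$ over linear functionals $\alpha$ on $H$ (roots); (b) for each root $\alpha\ne0$, $[\mathfrak{L}_\alpha,\mathfrak{L}_{-\alpha}]$ is one-dimensional; (c) for roots $\alpha,\beta$ with $\beta\neq0$, not all $\alpha+k\beta$ ($1\le k\le \ell-1$) are roots. The Killing form is $K(A,B)=2n\,\mathrm{Tr}(AB)$. A COD of $\mathfrak{sl}_n(\mathbb{F})$ is a vector space decomposition $\mathfrak{sl}_n(\mathbb{F})=H_0\oplus\cdots\oplus H_n$ into classical Cartan subalgebras that are pairwise orthogonal with respect to $K$. Two CODs are conjugate if there is a Lie algebra automorphism of $\mathfrak{sl}_n(\mathbb{F})$ mapping each component of the first decomposition onto exactly one component of the second. *)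

(* Defs.v *)
From HB Require Import structures.
From mathcomp Require Import all_boot all_order all_algebra.
Unset Strict Implicit. Unset Printing Implicit Defensive.
Import Order.TTheory GRing.Theory.
Local Open Scope ring_scope.
Local Open Scope vspace_scope.

Section SlDefs.
Variables (F : fieldType) (n : nat).

Notation M := 'M[F]_n.

Definition lie (x y : M) : M := x *m y - y *m x.

Definition trace_lfun : 'Hom(M, F^o) := linfun (fun A : M => (\tr A : F^o)).

Definition sl : {vspace M} := lker trace_lfun.

Definition liebr (A B : {vspace M}) : {vspace M} :=
  (\sum_(x <- vbasis A) \sum_(y <- vbasis B) <[lie x y]>)%VS.

Definition subalgebra (H : {vspace M}) : Prop :=
  (H <= sl)%VS /\ forall x y, x \in H -> y \in H -> lie x y \in H.

Definition lie_nilpotent (H : {vspace M}) : Prop :=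
  exists k : nat, forall (s : seq M) (y : M), size s = k ->
    all (fun x => x \in H) s -> y \in H -> foldr lie y s = 0%R.

Definition self_normalizing (H : {vspace M}) : Prop :=
  forall x, x \in sl -> (forall h, h \in H -> lie x h \in H) -> x \in H.

Definition cartan (H : {vspace M}) : Prop :=
  [/\ subalgebra H, lie_nilpotent H & self_normalizing H].

Definition lie_abelian (H : {vspace M}) : Prop :=
  forall x y, x \in H -> y \in H -> lie x y = 0%R.

Definition rootspace (H : {vspace M}) (a : 'Hom(subvs_of H, F^o)) : {vspace M} :=
  (sl :&: \bigcap_(h <- vbasis H)
      lker (linfun (fun x : M => lie x h - (a (vsproj H h) : F) *: x)))%VS.

Definition is_root (H : {vspace M}) (a : 'Hom(subvs_of H, F^o)) : bool :=
  rootspace H a != 0%VS.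

(* classical Cartan subalgebra, l = char F *)
Definition classical_cartan (l : nat) (H : {vspace M}) : Prop :=
  [/\ cartan H, lie_abelian H,
    (exists rs : seq 'Hom(subvs_of H, F^o),
       [/\ uniq rs, all (is_root H) rs,
           (\sum_(a <- rs) rootspace H a)%VS = sl &
           directv (\sum_(a <- rs) rootspace H a)]),
    (forall a, is_root H a -> a != 0%R ->
       \dim (liebr (rootspace H a) (rootspace H (- a)%R)) = 1%N) &
    (forall a b, is_root H a -> is_root H b -> b != 0%R ->
       exists k : nat, [/\ (1 <= k)%N, (k <= l.-1)%N & ~~ is_root H (a + b *+ k)%R])].

Definition killing (A B : M) : F := (2 * n)%:R * \tr (A *m B).

Definition COD (l : nat) (H : 'I_n.+1 -> {vspace M}) : Prop :=
  [/\ forall i, classical_cartan l (H i),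
      forall i j, i != j -> forall x y, x \in H i -> y \in H j -> killing x y = 0%R,
      (\sum_i H i)%VS = sl &
      directv (\sum_i H i)].

(* Lie algebra automorphism of sl_n (given by a linear map of the ambient
   matrix space, restricted to sl_n) *)
Definition lie_automorphism (phi : 'End(M)) : Prop :=
  [/\ (phi @: sl)%VS = sl, (lker phi :&: sl)%VS = 0%VS &
      forall x y, x \in sl -> y \in sl -> phi (lie x y) = lie (phi x) (phi y)].

Definition COD_conjugate (H1 H2 : 'I_n.+1 -> {vspace M}) : Prop :=
  exists phi : 'End(M), lie_automorphism phi /\
    forall i, exists! j, (phi @: H1 i)%VS = H2 j.

End SlDefs.
Arguments lie {F n}.
Arguments sl {F n}.
Arguments COD {F n}.
Arguments COD_conjugate {F n}.
Arguments killing {F n}.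

(* Main.v *)
(** A classical Cartan subalgebra [H] is simultaneously diagonalizable: if [w]
    is a common eigenvector, so is [w *m x] for every root vector [x]. As [H] is
    self-normalizing, it consists of all traceless matrices that are diagonal
    in some basis. Conjugate a COD so that [H 0] is the diagonal subalgebra. For
    [H i] with basis the rows of [P], orthogonality to [H 0] says that
    [P k i * invmx P i k = 1/3]; since two numbers with sum -1
    whose inverses also have sum -1 are the primitive cube roots of unity, [P]
    is the Fourier matrix up to scaling of rows and columns. A further diagonal
    conjugation makes [H 1] the subalgebra of circulants, and orthogonality to
    the circulants leaves only two possibilities for [H 2] and [H 3], which are
    distinct because the form is nonzero on each component. *)
Require Import Defs.
From HB Require Import structures.
From mathcomp Require Import all_boot all_order all_algebra.
From mathcomp Require Import perm ring.
Import GRing.Theory.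
Set Implicit Arguments.
Unset Strict Implicit.
Unset Printing Implicit Defensive.
Local Open Scope ring_scope.

(** * Conjugation, and the Cartan subalgebra attached to a basis *)

Section Cartan.
Variables (F : fieldType) (n : nat).
Implicit Types (A B P g : 'M[F]_n) (H : {vspace 'M[F]_n}).

Lemma mem_sl A : (A \in sl) = (\tr A == 0).
Proof. by rewrite memv_ker lfunE. Qed.

Definition conjL g : 'End('M[F]_n) := linfun (mulmxr g \o mulmx (invmx g)).

Lemma conjLE g A : conjL g A = invmx g *m A *m g.
Proof. by rewrite lfunE. Qed.

Lemma conjL_mul g1 g2 A : g1 \in unitmx -> g2 \in unitmx ->
  conjL (g1 *m g2) A = conjL g2 (conjL g1 A).
Proof.
move=> u1 u2; have u12 : g1 *m g2 \in unitmx by rewrite unitmx_mul u1.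
rewrite !conjLE -2!mulmxA -[RHS](mulKmx u12); congr (_ *m _).
by rewrite -!mulmxA mulKVmx // mulKVmx.
Qed.

Lemma conjLK g : g \in unitmx -> cancel (conjL g) (conjL (invmx g)).
Proof.
by move=> ug A; rewrite !conjLE invmxK !mulmxA mulmxV // mul1mx mulmxK.
Qed.

Lemma conjL_img_mul g1 g2 U : g1 \in unitmx -> g2 \in unitmx ->
  (conjL g2 @: (conjL g1 @: U))%VS = (conjL (g1 *m g2) @: U)%VS.
Proof.
move=> u1 u2; rewrite -limg_comp; congr (_ @: _)%VS.
by apply/lfunP => A; rewrite lfunE /= conjL_mul.
Qed.

Lemma conjL_imgK g U : g \in unitmx ->
  (conjL (invmx g) @: (conjL g @: U))%VS = U.
Proof.
move=> ug; rewrite -limg_comp -[RHS]lim1g; congr (_ @: _)%VS.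
by apply/lfunP => A; rewrite !lfunE /= conjLK.
Qed.

Lemma mxtrace_conjL g A : g \in unitmx -> \tr (conjL g A) = \tr A.
Proof. by move=> ug; rewrite conjLE mxtrace_mulC mulKVmx. Qed.

Lemma conjLM g A B : g \in unitmx ->
  conjL g (A *m B) = conjL g A *m conjL g B.
Proof. by move=> ug; rewrite !conjLE !mulmxA mulmxK. Qed.

Lemma conjL_lie_automorphism g : g \in unitmx -> lie_automorphism F n (conjL g).
Proof.
move=> ug.
have sub h : h \in unitmx -> (conjL h @: sl <= sl)%VS.
  move=> uh; apply/subvP => _ /memv_imgP[A Asl ->].
  by rewrite mem_sl mxtrace_conjL // -mem_sl.
split=> [||A B _ _].
- apply/eqP; rewrite eqEsubv sub //=.
  rewrite -{1}[sl](@conjL_imgK (invmx g)) ?unitmx_inv // invmxK limgS //.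
  by rewrite sub ?unitmx_inv.
- have /lker0P/eqP-> := can_inj (conjLK ug); exact: cap0v.
by rewrite /lie linearB /= !conjLM.
Qed.

Lemma killing_conjL g A B : g \in unitmx ->
  killing (conjL g A) (conjL g B) = killing A B.
Proof. by move=> ug; rewrite /killing -conjLM // mxtrace_conjL. Qed.

Definition diag_sl : {vspace 'M[F]_n} :=
  (limg (linfun (@diag_mx F n)) :&: sl)%VS.

(* The traceless matrices for which every row of [P] is an eigenvector. *)
Definition cart P : {vspace 'M[F]_n} := (conjL P @: diag_sl)%VS.

Lemma mem_diag_sl A :
  A \in diag_sl <-> (exists d, A = diag_mx d) /\ \tr A = 0.
Proof.
rewrite memv_cap mem_sl; split.
  by case/andP=> /memv_imgP[d _ ->] /eqP; rewrite !lfunE; split => //; exists d.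
move=> [[d ->] ->]; rewrite eqxx andbT; apply/memv_imgP; exists d => //.
  exact: memvf.
by rewrite lfunE.
Qed.

Lemma mem_cart P A : P \in unitmx ->
  A \in cart P <-> (exists d, P *m A = diag_mx d *m P) /\ \tr A = 0.
Proof.
move=> uP; split.
  case/memv_imgP=> B /mem_diag_sl[[d ->] trB] ->.
  rewrite mxtrace_conjL //; split=> //; exists d.
  by rewrite conjLE !mulmxA mulmxV // mul1mx.
move=> [[d PA] trA]; apply/memv_imgP; exists (diag_mx d).
  apply/mem_diag_sl; split; first by exists d.
  by rewrite -trA -[A](mulKmx uP) PA mxtrace_mulC mulmxK.
by rewrite conjLE -mulmxA -PA mulKmx.
Qed.

Lemma conjL_cart P g : P \in unitmx -> g \in unitmx ->
  (conjL g @: cart P)%VS = cart (P *m g).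
Proof. exact: conjL_img_mul. Qed.

Lemma cart1 : cart 1%:M = diag_sl.
Proof.
rewrite -[RHS]lim1g; congr (_ @: _)%VS; apply/lfunP => A.
by rewrite conjLE lfunE /= invmx1 mul1mx mulmx1.
Qed.

Lemma dim_cart P : P \in unitmx -> \dim (cart P) = \dim diag_sl.
Proof.
move=> uP; apply: limg_dim_eq.
by have /lker0P/eqP-> := can_inj (conjLK uP); exact: capv0.
Qed.

(** Row [i] of [P] is an eigenvector of every [A] in [cart Q], with the eigenvalue of row [k i] of
    [Q]. This gives one inclusion, and both sides have the dimension of [diag_sl]. *)
Lemma eq_cart P Q : P \in unitmx -> Q \in unitmx ->
  (forall i, exists k c, row i P = c *: row k Q) -> cart P = cart Q.
Proof.
move=> uP uQ /fin_all_exists[k] /fin_all_exists[c] PQ.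
apply/esym/eqP; rewrite eqEdim !dim_cart // leqnn andbT.
apply/subvP=> A /mem_cart[] // [d QA] trA; apply/mem_cart => //; split=> //.
exists (\row_i d 0 (k i)); apply/row_matrixP => i.
rewrite row_mul PQ -scalemxAl -row_mul QA.
by rewrite !row_mul !row_diag_mx -!scalemxAl -!rowE mxE PQ !scalerA mulrC.
Qed.

End Cartan.

(** * Simultaneous diagonalization of classical Cartan subalgebras *)

Section Diagonalization.
Variables (F : closedFieldType) (m : nat).
Local Notation n := m.+1.
Hypothesis n_neq0 : (n%:R : F) != 0.
Implicit Types (A h : 'M[F]_n) (H : {vspace 'M[F]_n}).

Lemma mem_rootspace H (a : 'Hom(subvs_of H, F^o)) x h :
  x \in rootspace F n H a -> h \in vbasis H ->
  lie x h = (a (vsproj H h) : F) *: x.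
Proof.
rewrite memv_cap => /andP[_ xa] hH.
have lin : linear (fun x : 'M[F]_n => lie x h - (a (vsproj H h) : F) *: x).
  move=> c u v; rewrite /lie mulmxDl mulmxDr -scalemxAl -scalemxAr.
  by apply/matrixP => i j; rewrite !mxE; ring.
(* [lfunE] needs a linear structure, which the bare function in [rootspace] lacks. *)
pose L : {linear 'M[F]_n -> 'M[F]_n} := HB.pack
  (fun x : 'M[F]_n => lie x h - (a (vsproj H h) : F) *: x)
  (GRing.isLinear.Build F _ _ _ _ lin).
have : x \in lker (linfun L).
  by move: xa; apply: subvP; rewrite (big_rem h) //= capvSl.
by rewrite memv_ker lfunE /= subr_eq0 => /eqP.
Qed.

Lemma closed_eigenvector h : exists2 w : 'rV[F]_n,
  w != 0 & exists c, w *m h = c *: w.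
Proof.
have /closed_rootP[c] : size (char_poly h) != 1%N by rewrite size_char_poly.
rewrite -eigenvalue_root_char => /eigenvalueP[w wh w0].
by exists w => //; exists c.
Qed.

(* The vectors [w *m x], with [x] a root vector, and [w] itself span the space
   since [sl] and the scalars span all matrices. *)
Lemma diagonalizable_root H (rs : seq 'Hom(subvs_of H, F^o)) h :
  (\sum_(a <- rs) rootspace F n H a)%VS = sl -> h \in vbasis H ->
  diagonalizable h.
Proof.
move=> rsE hH; have [w w0 [c wh]] := closed_eigenvector h.
(* From [lie x h = a(h) x] and [w h = c w] follows [w x h = (c + a(h)) w x], so these are the
   possible eigenvalues. *)
pose es := undup (c :: [seq c + (a (vsproj H h) : F) 
    | a : 'Hom(subvs_of H, F^o) <- rs]).
apply/diagonalizablePeigen; exists es; first exact: undup_uniq.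
have in_es r (v : 'rV_n) : r \in es -> v *m h = r *: v ->
    (v <= \sum_(r <- es) eigenspace h r)%MS.
  move=> res /eigenspaceP vr; apply: submx_trans vr _.
  by rewrite (big_rem r) //= addsmxSl.
apply/eqmxP/andP; split; first exact: submx1.
apply/row_subP => i; set v := row i _.
(* A nonzero row has a right inverse, so any [v] is [w *m X] for some [X]. *)
pose X := pinvmx w *m v.
have -> : v = w *m X.
  rewrite mulmxA mulmxVp ?mul1mx // /row_free eqn_leq rank_leq_row /=.
  by rewrite lt0n mxrank_eq0.
clearbody X => {i v}; pose t := \tr X / n%:R.
have -> : X = (X - t%:M) + t%:M by rewrite subrK.
rewrite mulmxDr addmx_sub //; last first.
  by rewrite mul_mx_scalar scalemx_sub // (in_es c) // mem_undup mem_head.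
have : X - t%:M \in (\sum_(a <- rs) rootspace F n H a)%VS.
  rewrite rsE mem_sl linearB /= mxtrace_scalar -mulr_natr /t.
  by rewrite divfK // subrr.
(* The induction runs over lists contained in [rs], so that [es] stays fixed. *)
move: (X - t%:M) => Y; have: {subset rs <= rs} by [].
elim: {1 3}rs Y => [|a s IHs] Y s_rs.
  by rewrite big_nil memv0 => /eqP->; rewrite mulmx0 sub0mx.
rewrite big_cons => /memv_addP[x xa [y ys ->]].
rewrite mulmxDr addmx_sub //; last first.
  by apply: IHs ys => b bs; rewrite s_rs // in_cons bs orbT.
apply: (in_es (c + (a (vsproj H h) : F))).
  rewrite mem_undup in_cons; apply/orP; right.
  by apply/mapP; exists a => //; rewrite s_rs ?mem_head.
have /eqP := mem_rootspace xa hH; rewrite /lie subr_eq => /eqP xh.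
by rewrite -mulmxA xh mulmxDr mulmxA wh -scalemxAl -scalemxAr scalerDl addrC.
Qed.

(** Codiagonalizing a basis of [H] puts [H] inside some [cart P]. Since [cart P] is abelian, it
    normalizes [H], hence lies in [H]. *)
Lemma classical_cartan_cart l H : classical_cartan F n l H ->
  exists2 P, P \in unitmx & H = cart P.
Proof.
case=> [[[Hsl _] _ selfn] abel [rs [_ _ rsE _]] _ _].
have /codiagonalizableP[P uP PH] : {in vbasis H &, forall A B, comm_mx A B} /\
    {in vbasis H, forall A, diagonalizable A}.
  split=> [A B AH BH|A AH]; last exact: diagonalizable_root rsE AH.
  by apply/eqP; rewrite -subr_eq0; apply/eqP/abel; apply: vbasis_mem.
have HP : (H <= cart P)%VS.
  rewrite -{1}(span_basis (vbasisP H)); apply/span_subvP => A AH.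
  apply/mem_cart => //; split.
    have /(allP PH) /= := AH.
    by move=> /diagonalizable_forPex[d /(simmxP uP) PA]; exists d.
  by apply/eqP; rewrite -mem_sl (subvP Hsl) // vbasis_mem.
exists P => //; apply/eqP; rewrite eqEsubv HP; apply/subvP => A AP.
have Asl : A \in sl by rewrite mem_sl; case/mem_cart: AP => // _ ->.
apply: selfn => // B /(subvP HP) BP.
suff -> : lie A B = 0 by exact: mem0v.
have [[a PA] _] := (mem_cart A uP).1 AP; have [[b PB] _] := (mem_cart B uP).1 BP.
apply: (can_inj (mulKmx uP)); rewrite /lie mulmxBr mulmx0 !mulmxA PA PB.
by rewrite -!mulmxA PA PB !mulmxA diag_mxC subrr.
Qed.
End Diagonalization.

(** * Orthogonality to the diagonal subalgebra *)

Section Orthogonality.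
Variables (F : fieldType) (n : nat).
Hypothesis n2_neq0 : ((2 * n)%:R : F) != 0.
Implicit Types (P Q : 'M[F]_n) (U V : {vspace 'M[F]_n}).

Definition orth U V := forall x y, x \in U -> y \in V -> killing x y = 0.

Lemma orth_conjL g U V : g \in unitmx -> orth U V ->
  orth (conjL g @: U) (conjL g @: V).
Proof.
move=> ug UV _ _ /memv_imgP[x xU ->] /memv_imgP[y yV ->].
by rewrite killing_conjL // UV.
Qed.

Lemma orth_trace U V x y : orth U V -> x \in U -> y \in V -> \tr (x *m y) = 0.
Proof.
move=> UV xU yV; have /eqP := UV _ _ xU yV.
by rewrite mulf_eq0 (negPf n2_neq0) => /eqP.
Qed.

Lemma delta_sub_diag_sl i j : delta_mx i i - delta_mx j j \in diag_sl F n.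
Proof.
have deltaE k : delta_mx k k = diag_mx (delta_mx 0 k) :> 'M[F]_n.
  apply/matrixP => a b; rewrite !mxE eqxx /=; case: (eqVneq a b) => [->|].
    by rewrite andbb.
  by case: (eqVneq a k) => [->|//]; rewrite eq_sym => /negPf->.
apply/mem_diag_sl; split.
  by exists (delta_mx 0 i - delta_mx 0 j); rewrite linearB /= !deltaE.
rewrite linearB /=; apply/eqP; rewrite subr_eq0; apply/eqP.
have tr1 k : \tr (delta_mx k k : 'M[F]_n) = 1.
  rewrite /mxtrace (bigD1 k) //= mxE !eqxx big1 ?addr0 // => l /negPf lk.
  by rewrite mxE lk.
by rewrite !tr1.
Qed.

Lemma trace_delta_conjL P i k :
  \tr (delta_mx i i *m conjL P (delta_mx k k)) = invmx P i k * P k i.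
Proof.
rewrite conjLE -(mul_delta_mx (0 : 'I_1) i i) -mulmxA mxtrace_mulC -rowE.
rewrite -(mul_delta_mx (0 : 'I_1) k k) mulmxA -colE -mulmxA -rowE.
by rewrite -colE /mxtrace big_ord1 !mxE big_ord1 !mxE.
Qed.

(** Pairing differences of diagonal units with conjugates of such differences shows that
    [m i k - m j k] does not depend on [k]. Rows and columns of [m] sum to 1, so summing over [j]
    makes [n * m i k - 1] independent of [k]; the row sum then gives the value. *)
Lemma orth_diag_entries P : P \in unitmx -> orth (diag_sl F n) (cart P) ->
  forall i k, invmx P i k * P k i = n%:R^-1.
Proof.
move=> uP oP; pose m i k := invmx P i k * P k i.
have n_neq0 : (n%:R : F) != 0.
  by move: n2_neq0; rewrite natrM mulf_eq0 negb_or => /andP[].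
have mE i j k l : m i k - m j k = m i l - m j l.
  apply/eqP; rewrite -subr_eq0; apply/eqP.
  have fkl := memv_img (conjL P) (delta_sub_diag_sl k l).
  rewrite -(orth_trace oP (delta_sub_diag_sl i j) fkl).
  rewrite linearB /= mulmxBl !mulmxBr !linearB /= !trace_delta_conjL.
  by rewrite /m; ring.
have row1 i : \sum_k m i k = 1.
  by have /matrixP/(_ i i) := mulVmx uP; rewrite !mxE eqxx.
have col1 k : \sum_i m i k = 1.
  have /matrixP/(_ k k) := mulmxV uP; rewrite !mxE eqxx => e.
  apply: (etrans _ e).
  by apply: eq_bigr => i _; rewrite /m mulrC.
have mrow i k l : m i k = m i l.
  have : \sum_j (m i k - m j k) = \sum_j (m i l - m j l).
    by apply: eq_bigr => j _; apply: mE.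
  rewrite !sumrB !col1 !sumr_const card_ord => /addIr.
  by rewrite -[LHS]mulr_natr -[RHS]mulr_natr => /(mulIf n_neq0).
move=> i k; apply: (mulIf n_neq0); rewrite mulVf //; apply: etrans (row1 i).
rewrite -/(m i k) mulr_natr (eq_bigr (fun=> m i k)) => [|l _]; last exact: mrow.
by rewrite sumr_const card_ord.
Qed.

End Orthogonality.

(** * Dimension three: the Fourier matrix and its diagonal twists *)

Section Dimension3.
Variables (F : fieldType) (w : F).
Hypothesis w_root : w ^+ 2 = - w - 1.
Hypothesis n2_neq0 : ((2 * 3)%:R : F) != 0.
Implicit Types (P Q : 'M[F]_3) (d : 'rV[F]_3).

Let neq3 : (3%:R : F) != 0.
Proof. by move: n2_neq0; rewrite natrM mulf_eq0 negb_or => /andP[]. Qed.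

Lemma cube_w : w ^+ 3 = 1.
Proof. by apply/eqP; rewrite -subr_eq0; apply/eqP; ring: w_root. Qed.

Lemma sum_ord3 (V : nmodType) (f : 'I_3 -> V) :
  \sum_i f i = f 0 + f 1 + f (1 + 1).
Proof.
rewrite !big_ord_recl big_ord0 addr0 addrA.
by congr (f _ + f _ + f _); apply: val_inj.
Qed.

Lemma ord3P (i : 'I_3) : [\/ i = 0, i = 1 | i = 1 + 1].
Proof.
case: i => [[|[|[|//]]] lti3];
  [apply: Or31|apply: Or32|apply: Or33]; exact: val_inj.
Qed.

(** Eliminating [z] and clearing denominators leaves [x^2 + x y + y^2 = 0], which factors as
    [(y - w x)(y - w^2 x) = 0]. *)
Lemma two_power_sums_eq0 (x y z : F) : x != 0 -> y != 0 -> z != 0 ->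
  x + y + z = 0 -> x^-1 + y^-1 + z^-1 = 0 ->
  (y = w * x /\ z = w ^+ 2 * x) \/ (y = w ^+ 2 * x /\ z = w * x).
Proof.
move=> x0 y0 z0 s1 s2.
have zE : z = - (x + y) by apply/eqP; rewrite -addr_eq0 addrC s1.
have e2 : x * y + y * z + z * x = 0.
  suff -> : x * y + y * z + z * x = x * y * z * (x^-1 + y^-1 + z^-1).
    by rewrite s2 mulr0.
  by field; rewrite x0 y0 z0.
have : (y - w * x) * (y - w ^+ 2 * x) = 0.
  suff -> : (y - w * x) * (y - w ^+ 2 * x) = - (x * y + y * z + z * x).
    by rewrite e2 oppr0.
  by rewrite zE; ring: w_root.
move/eqP; rewrite mulf_eq0 !subr_eq0 => /orP[]/eqP yE; [left|right];
  by split=> //; rewrite zE yE; ring: w_root.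
Qed.

Definition dft : 'M[F]_3 := \matrix_(i, j) w ^+ (i * j).

Definition frame d := dft *m diag_mx d.

Lemma frameE d i j : frame d i j = w ^+ (i * j) * d 0 j.
Proof. by rewrite /frame mul_mx_diag !mxE. Qed.

Lemma row_frameE d i j : row i (frame d) 0 j = w ^+ (i * j) * d 0 j.
Proof. by rewrite [LHS]mxE frameE. Qed.

Lemma dft_unit : dft \in unitmx.
Proof.
(* Since 2 is -1 modulo 3, the second factor is the conjugate Fourier matrix, three times the
   inverse. *)
have : dft *m (\matrix_(i, j) w ^+ (2 * i * j)) = 3%:R%:M.
  apply/matrixP => i j; rewrite !mxE sum_ord3 !mxE.
  by case: (ord3P i) => ->; case: (ord3P j) => -> /=; ring: w_root.
move=> dftM; have: dft *m (\matrix_(i, j) w ^+ (2 * i * j)) \in unitmx.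
  by rewrite dftM unitmxE det_scalar unitrX ?unitfE.
by rewrite unitmx_mul => /andP[].
Qed.

Lemma diag_unit d : (forall j, d 0 j != 0) -> diag_mx d \in unitmx.
Proof.
by move=> d0; rewrite unitmxE det_diag unitfE; apply/prodf_neq0 => j _.
Qed.

Lemma frame_unit d : (forall j, d 0 j != 0) -> frame d \in unitmx.
Proof. by move=> d0; rewrite unitmx_mul dft_unit diag_unit. Qed.

(* The rows of [P] and the rows of [frame d] agree up to scalars, where [d] is
   the first row of [P]: dividing by [d] entrywise, the orthogonality relations
   say that the entries of each other row, and their inverses, sum to 0. *)
Lemma orth_diag_frame P : P \in unitmx -> orth (diag_sl F 3) (cart P) ->
  exists2 d : 'rV[F]_3, (forall j, d 0 j != 0) & cart P = cart (frame d).
Proof.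
move=> uP oP; have PV := orth_diag_entries n2_neq0 uP oP.
have P0 i j : P i j != 0.
  by apply: contraNneq (invr_neq0 neq3) => Pij; rewrite -(PV j i) Pij mulr0.
have VE j i : invmx P j i = 3%:R^-1 / P i j.
  by apply: (mulIf (P0 i j)); rewrite PV divfK.
have d0 j : row 0 P 0 j != 0 by rewrite mxE.
exists (row 0 P); first exact: d0.
apply: eq_cart => // [|i]; first exact: frame_unit.
(* These are the off-diagonal entries of [P *m invmx P], rewritten with [VE]. Used for [(i, 0)] and
   [(0, i)], they give the sum of the ratios and of their inverses. *)
have PP i1 i2 : i1 != i2 -> \sum_j P i1 j / P i2 j = 0.
  move=> /negPf ne; have /matrixP/(_ i1 i2) := mulmxV uP; rewrite !mxE ne.
  rewrite (eq_bigr (fun j => 3%:R^-1 * (P i1 j / P i2 j))) => [|j _].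
    rewrite -mulr_sumr => /eqP.
    by rewrite mulf_eq0 invr_eq0 (negPf neq3) => /eqP.
  by rewrite VE mulrCA.
case: (eqVneq i 0) => [->|ne].
  by exists 0, 1; apply/rowP => j; rewrite scale1r row_frameE expr0 mul1r mxE.
have s1 := PP _ _ ne; rewrite eq_sym in ne; have s2 := PP _ _ ne.
rewrite sum_ord3 in s1; rewrite sum_ord3 in s2.
have a0 j : P i j / P 0 j != 0 by rewrite mulf_neq0 ?invr_eq0.
have aV j : P 0 j / P i j = (P i j / P 0 j)^-1 by rewrite invf_div.
rewrite !aV in s2.
have PE j : P i j = P i j / P 0 j * P 0 j by rewrite divfK.
have [[e1 e2]|[e1 e2]] := two_power_sums_eq0 (a0 0) (a0 1) (a0 (1 + 1)) s1 s2;
  [exists 1 | exists (1 + 1)]; exists (P i 0 / P 0 0); apply/rowP => j;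
  rewrite [LHS]mxE [RHS]mxE row_frameE mxE;
  case: (ord3P j) => ->; rewrite [LHS]PE ?e1 ?e2 /=; ring: w_root.
Qed.

Definition shift : 'M[F]_3 := \matrix_(i, j) (j == i + 1)%:R.

(** These two circulants are the test elements for orthogonality to [cart dft]. *)
Lemma shift_cart_dft : shift \in cart dft /\ shift^T \in cart dft.
Proof.
split; apply/mem_cart; rewrite ?dft_unit //.
  split; last by rewrite /mxtrace sum_ord3 !mxE /= !addr0.
  exists (\row_i w ^+ (2 * i)); apply/matrixP => i j.
  rewrite mul_diag_mx !mxE sum_ord3 !mxE.
  by case: (ord3P i) => ->; case: (ord3P j) => -> /=; ring: w_root.
split; last by rewrite /mxtrace sum_ord3 !mxE /= !addr0.
exists (\row_i w ^+ i); apply/matrixP => i j.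
rewrite mul_diag_mx !mxE sum_ord3 !mxE.
by case: (ord3P i) => ->; case: (ord3P j) => -> /=; ring: w_root.
Qed.

Lemma conjL_diagE d (A : 'M[F]_3) : (forall j, d 0 j != 0) ->
  conjL (diag_mx d) A = \matrix_(i, j) ((d 0 i)^-1 * A i j * d 0 j).
Proof.
move=> d0; have ud := diag_unit d0.
rewrite conjLE; apply: (can_inj (mulKmx ud)).
rewrite -mulmxA mulKVmx //; apply/matrixP => i j.
by rewrite mul_mx_diag mul_diag_mx !mxE !mulrA mulfV // mul1r.
Qed.

Definition last_scaling (v : F) : 'rV[F]_3 := \row_j (if j == 1 + 1 then v else 1).

Lemma w_neq0 : w != 0.
Proof.
by apply: contraTneq (oner_neq0 F) => w0; rewrite -cube_w w0 expr0n eqxx.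
Qed.

Lemma last_scaling_neq0 v : v != 0 -> forall j, last_scaling v 0 j != 0.
Proof. by move=> v0 j; rewrite mxE; case: ifP => // _; apply: oner_neq0. Qed.

(** Scaling the columns by [1, x, x^2] with [x = w^k] only moves row [i] of the Fourier matrix to
    row [i + k], so just the factor [v] on the last column matters. *)
Lemma cart_frame_last_scaling d v x : (forall j, d 0 j != 0) -> v != 0 ->
  x ^+ 3 = 1 -> d 0 1 = x * d 0 0 -> d 0 (1 + 1) = v * x ^+ 2 * d 0 0 ->
  cart (frame d) = cart (frame (last_scaling v)).
Proof.
move=> d0 v0 x3 d1 d2; have [k xE] : exists k : 'I_3, x = w ^+ k.
  have : (x - 1) * (x - w) * (x - w ^+ 2) = 0.
    suff -> : (x - 1) * (x - w) * (x - w ^+ 2) = x ^+ 3 - 1 by rewrite x3 subrr.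
    by ring: w_root.
  move/eqP; rewrite !mulf_eq0 !subr_eq0 -orbA => /or3P[] /eqP->.
  - by exists 0.
  - by exists 1.
  by exists (1 + 1).
apply: eq_cart => [||i]; [exact: frame_unit|
  exact/frame_unit/last_scaling_neq0|].
exists (i + k), (d 0 0); apply/rowP => j.
rewrite row_frameE [RHS]mxE row_frameE mxE.
case: (ord3P j) => ->; rewrite ?d1 ?d2 ?xE;
  by case: (ord3P i) => ->; case: (ord3P k) => -> /=; ring: w_root.
Qed.

(** The traces against the shift and its transpose say that the cyclic ratios [x, y, z] of the
    entries of [d], and their inverses, sum to 0. Hence [y] is [w x] or [w^2 x], and [x y z = 1]
    forces [x^3 = 1]. *)
Lemma orth_dft_frame d : (forall j, d 0 j != 0) ->
  orth (cart dft) (cart (frame d)) ->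
  cart (frame d) = cart (frame (last_scaling w)) \/
  cart (frame d) = cart (frame (last_scaling (w ^+ 2))).
Proof.
move=> d0 od; have [X X'] := shift_cart_dft; have ud := diag_unit d0.
have conj_in A : A \in cart dft -> conjL (diag_mx d) A \in cart (frame d).
  by rewrite -conjL_cart ?dft_unit //; apply: memv_img.
have := orth_trace n2_neq0 od X' (conj_in _ X).
have := orth_trace n2_neq0 od X (conj_in _ X').
rewrite !conjL_diagE // /mxtrace !sum_ord3 !mxE !sum_ord3 !mxE /=.
rewrite !(mul0r, mul1r, mulr0, mulr1, addr0, add0r) => s2 s1.
pose x := d 0 1 / d 0 0; pose y := d 0 (1 + 1) / d 0 1.
pose z := d 0 0 / d 0 (1 + 1).
have [x0 y0 z0] : [/\ x != 0, y != 0 & z != 0] by rewrite !mulf_neq0 ?invr_eq0.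
have xyz : x * y * z = 1 by rewrite /x /y /z; field; rewrite !d0.
have t1 : x + y + z = 0 by rewrite -s1 /x /y /z; ring.
have t2 : x^-1 + y^-1 + z^-1 = 0 by rewrite -s2 /x /y /z; field; rewrite !d0.
have d1E : d 0 1 = x * d 0 0 by rewrite divfK.
have d2E : d 0 (1 + 1) = y * d 0 1 by rewrite divfK.
case: (two_power_sums_eq0 x0 y0 z0 t1 t2) => -[yE zE]; [left|right];
  apply: (cart_frame_last_scaling (x := x));
  rewrite ?expf_neq0 ?w_neq0 // ?d2E ?d1E ?yE;
  try ring; rewrite -xyz yE zE; ring: w_root.
Qed.
Lemma cart_diag d : (forall j, d 0 j != 0) -> cart (diag_mx d) = diag_sl F 3.
Proof.
move=> d0; rewrite -cart1; apply: eq_cart => [||i]; rewrite ?diag_unit ?unitmx1 //.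
by exists i, (d 0 i); rewrite row_diag_mx row1.
Qed.

(** The difference of two diagonal units has a square of trace 2, nonzero in [F]. *)
Lemma cart_not_self_orth P : P \in unitmx -> ~ orth (cart P) (cart P).
Proof.
move=> uP oP; have D := delta_sub_diag_sl F (0 : 'I_3) 1.
have := orth_trace n2_neq0 oP (memv_img (conjL P) D) (memv_img (conjL P) D).
rewrite -conjLM // mxtrace_conjL // /mxtrace sum_ord3 !mxE !sum_ord3 !mxE /=.
move=> e; have two0 : 2%:R = 0 :> F by rewrite -e; ring.
by move: n2_neq0; rewrite natrM two0 mul0r eqxx.
Qed.

(** The list has four entries, so the default [0] is never reached. *)
Definition std_cod (i : 'I_4) : {vspace 'M[F]_3} :=
  cart (nth 0 [:: 1%:M; dft; frame (last_scaling w); frame (last_scaling (w ^+ 2))] i).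

Lemma COD_standard (H : 'I_4 -> {vspace 'M[F]_3}) (P : 'I_4 -> 'M[F]_3) :
  (forall i, P i \in unitmx) -> (forall i, H i = cart (P i)) ->
  (forall i j, i != j -> orth (H i) (H j)) ->
  exists2 g, g \in unitmx &
    exists s : {perm 'I_4}, forall i, (conjL g @: H i)%VS = std_cod (s i).
Proof.
move=> uP HP oH; pose g1 := invmx (P 0).
have ug1 : g1 \in unitmx by rewrite unitmx_inv.
have H0 : (conjL g1 @: H 0%R)%VS = diag_sl F 3 by rewrite HP conjL_imgK.
have [d d0 H1] : exists2 d : 'rV[F]_3, (forall j, d 0 j != 0) &
    (conjL g1 @: H 1%R)%VS = cart (frame d).
  rewrite HP conjL_cart //; apply: orth_diag_frame.
    by rewrite unitmx_mul uP.
  by rewrite -H0 -conjL_cart // -HP; apply/orth_conjL/oH.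
(* [g2] undoes the column scaling of [H 1] and preserves the diagonal subalgebra. *)
have ud := diag_unit d0; pose g2 := invmx (diag_mx d).
have ug2 : g2 \in unitmx by rewrite unitmx_inv.
pose g := g1 *m g2; have ug : g \in unitmx by rewrite unitmx_mul ug1.
have gE i : (conjL g @: H i = conjL g2 @: (conjL g1 @: H i))%VS.
  by rewrite conjL_img_mul.
have G0 : (conjL g @: H 0%R)%VS = diag_sl F 3.
  by rewrite gE H0 -{1}(cart_diag d0) conjL_imgK.
have G1 : (conjL g @: H 1%R)%VS = cart dft.
  by rewrite gE H1 conjL_cart ?frame_unit // mulmxK.
have G23 i : i != 0 -> i != 1 ->
    (conjL g @: H i)%VS = std_cod (1 + 1) \/
    (conjL g @: H i)%VS = std_cod (1 + 1 + 1).
  move=> i0 i1.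
  have ogi j : i != j -> orth (conjL g @: H j) (conjL g @: H i).
    by rewrite eq_sym => ij; apply: orth_conjL => //; apply: oH.
  have [e e0 Ge] : exists2 e : 'rV[F]_3, (forall j, e 0 j != 0) &
      (conjL g @: H i)%VS = cart (frame e).
    have := ogi _ i0; rewrite G0 HP conjL_cart //.
    by apply: orth_diag_frame; rewrite unitmx_mul uP.
  by rewrite Ge; apply: orth_dft_frame => //; rewrite -G1 -Ge; apply: ogi.
have G_neq : (conjL g @: H (1 + 1)%R)%VS <> (conjL g @: H (1 + 1 + 1)%R)%VS.
  move=> eqG; have : orth (conjL g @: H (1 + 1)%R) (conjL g @: H (1 + 1 + 1)%R).
    by apply/orth_conjL/oH.
  rewrite -eqG HP conjL_cart //; apply: cart_not_self_orth.
  by rewrite unitmx_mul uP.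
have ord4P (Q : 'I_4 -> Prop) : Q 0 -> Q 1 -> Q (1 + 1) -> Q (1 + 1 + 1) ->
    forall i, Q i.
  move=> Q0 Q1 Q2 Q3 [[|[|[|[|//]]]] lti].
  - by rewrite (_ : Ordinal _ = 0); last exact: val_inj.
  - by rewrite (_ : Ordinal _ = 1); last exact: val_inj.
  - by rewrite (_ : Ordinal _ = 1 + 1); last exact: val_inj.
  by rewrite (_ : Ordinal _ = 1 + 1 + 1); last exact: val_inj.
exists g => //.
(* [H 2] and [H 3] fill the last two places in one order or the other, so the permutation is the
   identity or a transposition. *)
have [G2|G2] := G23 (1 + 1) isT isT; have [G3|G3] := G23 (1 + 1 + 1) isT isT.
- by case: G_neq; rewrite G2 G3.
- by exists 1%g; apply: ord4P; rewrite perm1 // G0 -cart1.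
- exists (tperm (1 + 1) (1 + 1 + 1)); apply: ord4P;
    rewrite ?tpermL ?tpermR ?tpermD // G0 -cart1 //.
- by case: G_neq; rewrite G2 G3.
Qed.

End Dimension3.

(** * Comparing two CODs through the standard one *)

Theorem theorem3p8 (F : closedFieldType) (p : nat) (hp : p \in [pchar F])
  (hp3 : (3 < p)%N) (H1 H2 : 'I_4 -> {vspace 'M[F]_3}) :
  COD p H1 -> COD p H2 -> COD_conjugate H1 H2.
Proof.
have n2_neq0 : ((2 * 3)%:R : F) != 0.
  rewrite -(dvdn_pcharf hp) Euclid_dvdM ?(pcharf_prime hp) // negb_or.
  by rewrite !gtnNdvd // ltnW.
have n_neq0 : (3%:R : F) != 0.
  by move: n2_neq0; rewrite natrM mulf_eq0 negb_or => /andP[].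
have [w w_root] : exists w : F, w ^+ 2 = - w - 1.
  (* With both lower coefficients set to -1, the monic equation reads [w^2 = -1 - w]. *)
  have [w wE] := @solve_monicpoly F 2 (fun=> -1) isT.
  by exists w; rewrite wE !big_ord_recl big_ord0 /=; ring.
have std H : COD p H ->
    (forall i j, H i = H j -> i = j) /\ exists2 g, g \in unitmx &
    exists s : {perm 'I_4}, forall i, (conjL g @: H i)%VS = std_cod w (s i).
  case=> cH oH _ _.
  have [P uP HP] := fin_all_exists2 (fun i => classical_cartan_cart n_neq0 (cH i)).
  split; last exact: (@COD_standard _ _ w_root n2_neq0 H P).
  (* Equal components with distinct indices would be orthogonal to themselves. This injectivity
     yields the uniqueness in [exists!]. *)
  move=> i j Hij; apply/eqP; apply: (contra_notT _ (cart_not_self_orth n2_neq0 (uP i))).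
  by move=> /oH; rewrite -Hij HP.
move=> /std[_ [g1 ug1 [s1 G1]]] /std[inj2 [g2 ug2 [s2 G2]]].
have ug2' : invmx g2 \in unitmx by rewrite unitmx_inv.
exists (conjL (g1 *m invmx g2)); split.
  by apply: conjL_lie_automorphism; rewrite unitmx_mul ug1.
(* [j] is the index whose component in [H2] has the same standard form as [H1 i]. *)
move=> i; pose j := (s2^-1)%g (s1 i).
have HE : (conjL (g1 *m invmx g2) @: H1 i)%VS = H2 j.
  by rewrite -conjL_img_mul // G1 -(conjL_imgK (H2 j) ug2) G2 permKV.
by exists j; split=> // k; rewrite HE => /inj2.
Qed.
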